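(* Let $T$ be a tree, let $\lambda: T\to(0,\infty)$ be a weight, let $1\le p<\infty$, and let $\varphi:T\to T$ be a self-map for which there is a constant $M$ such that $|\varphi^{-1}(v)|\le M$ for every $v\in\varphi(T)$, where $|A|$ denotes the number of elements of a set $A$. Put $$\beta_\varphi=\sup_{v\in T}\frac{\lambda(v)}{\lambda(\varphi(v))}\in(0,\infty].$$ Then the composition operator $C_\varphi$ is bounded on $L^p_\lambda(T)$ if and only if $\beta_\varphi$ is finite. Moreover, in that case, $\|C_\varphi\|\le (M\beta_\varphi)^{1/p}$.
   Context: A tree $T$ is a connected, locally finite graph without cycles on a countably infinite vertex set (identified with $T$), with a fixed vertex $o$ called the root, and with no terminal vertices (a terminal vertex is one having only one neighbour). Functions on $T$ are functions on its vertices. For a weight $\lambda:T\to(0,\infty)$ and $1\le p<\infty$, $L^p_\lambda(T)$ is the Banach space of functions $f:T\to\mathbb{C}$ with $\|f\|_p=\big[\sum_{v\in T}|f(v)|^p\lambda(v)\big]^{1/p}<\infty$. For a self-map $\varphi$ of $T$, the composition operator $C_\varphi$ is $C_\varphi f(v)=f(\varphi(v))$; it is bounded on $L^p_\lambda(T)$ if it maps $L^p_\lambda(T)$ into itself and is a bounded linear operator there, and $\|C_\varphi\|$ is then its operator norm. *)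

(* Defs.v *)
From mathcomp Require Import all_boot all_order all_algebra.
From mathcomp Require Import all_classical all_reals all_analysis.
From mathcomp Require Import complex.

Set Implicit Arguments.
Unset Strict Implicit.
Unset Printing Implicit Defensive.

Import Order.TTheory GRing.Theory Num.Theory.

Local Open Scope classical_set_scope.
Local Open Scope ring_scope.

Definition neighbours (V : choiceType) (adj : rel V) (v : V) : set V :=
  [set w | adj v w].

Definition terminal (V : choiceType) (adj : rel V) (v : V) : Prop :=
  exists w, neighbours adj v = [set w].

Record tree := Tree {
  vertex :> countType;
  adj : rel vertex;
  root : vertex;
  vertex_infinite : infinite_set [set: vertex];
  adj_sym : symmetric adj;
  adj_irr : irreflexive adj;
  tree_connected : forall x y, exists2 s, path adj x s & last x s = y;
  (* cycles of length 2 are edges traversed back and forth *)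
  tree_acyclic : forall c : seq vertex, (2 < size c)%N -> ~ ucycle adj c;
  tree_locally_finite : forall v, finite_set (neighbours adj v);
  tree_no_terminal : forall v, ~ terminal adj v }.

Section WeightedLp.
Context {R : realType} {T : choiceType}.
Implicit Types (lambda : T -> R) (p : R) (f g : T -> R[i]).
Implicit Types (A : (T -> R[i]) -> (T -> R[i])).
Local Open Scope ereal_scope.

(* The absolute value on R[i] is itself R[i]-valued; [complex.Re] recovers it
   as an element of R. *)
Definition Lpnorm lambda p f : \bar R :=
  (\esum_(v in [set: T]) ((complex.Re `|f v|) `^ p * lambda v)%:E) `^ p^-1.

Definition Lp lambda p : set (T -> R[i]) := [set f | Lpnorm lambda p f < +oo].

Definition bounded_operator lambda p A : Prop :=
  [/\ forall f, Lp lambda p f -> Lp lambda p (A f),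
      forall (a : R[i]) f g, Lp lambda p f -> Lp lambda p g ->
        A (fun v => a * f v + g v)%R = (fun v => a * A f v + A g v)%R
    & exists K : R, forall f, Lp lambda p f ->
        Lpnorm lambda p (A f) <= K%:E * Lpnorm lambda p f].

Definition operator_norm lambda p A : \bar R :=
  ereal_sup [set Lpnorm lambda p (A f) | f in [set f | Lpnorm lambda p f <= 1]].

Definition composition_operator (phi : T -> T) : (T -> R[i]) -> (T -> R[i]) :=
  fun f => f \o phi.

Definition beta lambda (phi : T -> T) : \bar R :=
  ereal_sup [set (lambda v / lambda (phi v))%:E | v in [set: T]].

End WeightedLp.

(* Main.v *)
(** Writing [a u] for [|f u|^p * lambda u], each term of [||C_phi f||^p] is at
    most [beta * a (phi v)], and grouping the vertices [v] by the fibres of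
    [phi] bounds the sum of [a (phi v)] by [M] times the sum of [a].
    Conversely, testing the boundedness of [C_phi] on the indicator of
    [phi v], whose image is the indicator of a fibre containing [v], gives
    [lambda v <= K^p * lambda (phi v)]. *)

Require Import Defs.
From mathcomp Require Import all_boot all_order all_algebra.
From mathcomp Require Import all_classical all_reals all_analysis.
From mathcomp Require Import complex.

Import Order.TTheory GRing.Theory Num.Theory.

Local Open Scope classical_set_scope.
Local Open Scope ring_scope.
Local Open Scope ereal_scope.

(** The constant factors out of each finite partial sum, which the full sum dominates. *)
Lemma esumZl_le (R : realType) (T : choiceType) (I : set T) (c : \bar R)
    (a : T -> \bar R) : 0 <= c -> (forall i, 0 <= a i) ->
  \esum_(i in I) (c * a i) <= c * \esum_(i in I) a i.
Proof.
move=> c0 a0; apply: ge_ereal_sup => _ [X [finX XI] <-].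
rewrite -ge0_mule_fsumr//; apply: lee_wpmul2l => //.
by apply: esum_ge; exists X.
Qed.

(** On the fibre over [u] the summand is the constant [a u], so that fibre contributes [a u] times
    its cardinality. *)
Lemma esum_comp_le (R : realType) (T U : choiceType) (phi : T -> U) (M : R)
    (a : U -> \bar R) : (0 <= M)%R ->
  (forall u, range phi u -> counting (phi @^-1` [set u]) <= M%:E) ->
  (forall u, 0 <= a u) ->
  \esum_(v in [set: T]) a (phi v) <= M%:E * \esum_(u in [set: U]) a u.
Proof.
move=> M0 fibre_le a0.
have -> : \esum_(v in [set: T]) a (phi v) =
    \esum_(u in [set: U]) \esum_(v in phi @^-1` [set u]) a (phi v).
  rewrite esum_esum//; symmetry.
  (* This map is a bijection from [T] onto the disjoint union of the fibres. *)
  apply: (reindex_esum _ _ (fun v => (phi v, v))) => //; split=> //.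
  - by move=> v v' _ _ [].
  - by move=> [_ v] [_ /= <-]; exists v.
apply: (le_trans _ (esumZl_le _ _ _ _ _ _ _)); rewrite ?lee_fin//.
apply: le_esum => u _.
(* The bound [M] is given only over the range; elsewhere the fibre is empty and its sum vanishes. *)
have [ru|nru] := pselect (range phi u); last first.
  rewrite (_ : _ @^-1` _ = set0) ?esum_set0 ?mule_ge0 ?lee_fin//.
  by apply/seteqP; split=> // v /= vu; apply: nru; exists v.
rewrite (eq_esum (b := fun=> a u * 1)) => [|v /= ->]; last by rewrite mule1.
apply: (le_trans (esumZl_le _ _ _ _ _ _ _)) => //.
rewrite muleC; apply: lee_wpmul2r => //; apply: le_trans (fibre_le u ru).
(* An infinite fibre has counting measure [+oo]; on a finite one the sum of ones is the
   cardinality. *)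
rewrite /counting; case: asboolP => [finF|_]; last exact: leey.
rewrite esum_fset// (eq_fsbigr (cst 1))//.
by rewrite fsbig_finite//= sumEFin card_fset_sum1 natr_sum.
Qed.

Section Lp_facts.
Variables (R : realType) (T : choiceType) (lambda : T -> R) (p : R).
Hypotheses (lambda_gt0 : forall v, (0 < lambda v)%R) (p_gt0 : (0 < p)%R).

Lemma Lpnorm_ge0 f : 0 <= Lpnorm lambda p f.
Proof. exact: poweR_ge0. Qed.

Lemma Lp_term_ge0 (f : T -> R[i]) (w v : T) :
  0 <= ((complex.Re `|f v|) `^ p * lambda w)%:E.
Proof. by rewrite lee_fin mulr_ge0 ?powR_ge0// ltW. Qed.

Lemma Lpnorm_indic (A : set T) :
  Lpnorm lambda p (fun v => (v \in A)%:R) =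
  (\esum_(v in A) (lambda v)%:E) `^ p^-1.
Proof.
rewrite /Lpnorm [in RHS]esum_mkcond; congr (_ `^ _).
apply: eq_esum => v _; case: ifP => _.
  by rewrite normr1 powR1 mul1r.
(* Positivity of [p] matters here: zero to the power zero is 1. *)
by rewrite normr0 powR0 ?mul0r// gt_eqF.
Qed.

Variable phi : T -> T.

Lemma ratio_le_beta v : (lambda v / lambda (phi v))%:E <= beta lambda phi.
Proof. by apply: ereal_sup_ubound; exists v. Qed.

(** The point [v] witnesses that [T] is inhabited; the supremum of the empty set would be [-oo]. *)
Lemma beta_ge0 (v : T) : 0 <= beta lambda phi.
Proof.
by apply: le_trans (ratio_le_beta v); rewrite lee_fin divr_ge0// ltW.
Qed.

(** This single inequality yields the invariance of [Lp], the boundedness and the bound on the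
    operator norm. *)
Lemma Lpnorm_comp_le (v0 : T) (M : R) (f : T -> R[i]) :
  (forall v, range phi v -> counting (phi @^-1` [set v]) <= M%:E) ->
  (0 <= M)%R -> beta lambda phi \is a fin_num ->
  Lpnorm lambda p (composition_operator phi f) <=
  (M%:E * beta lambda phi) `^ p^-1 * Lpnorm lambda p f.
Proof.
move=> fibre_le M0 bfin; have b0 := beta_ge0 v0.
have Mb0 : 0 <= M%:E * beta lambda phi by rewrite mule_ge0 ?lee_fin.
rewrite /Lpnorm -poweRM//; last by apply: esum_ge0 => v _; exact: Lp_term_ge0.
have S0 : 0 <= \esum_(v in [set: T])
    ((complex.Re `|composition_operator phi f v|) `^ p * lambda v)%:E.
  by apply: esum_ge0 => v _; exact: Lp_term_ge0.
have le_S : \esum_(v in [set: T])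
    ((complex.Re `|composition_operator phi f v|) `^ p * lambda v)%:E <=
    M%:E * beta lambda phi *
    \esum_(v in [set: T]) ((complex.Re `|f v|) `^ p * lambda v)%:E.
  pose a v := ((complex.Re `|f v|) `^ p * lambda v)%:E.
  have a0 v : 0 <= a v by exact: Lp_term_ge0.
  apply: (@le_trans _ _ (\esum_(v in [set: T]) (beta lambda phi * a (phi v)))).
    apply: le_esum => v _; rewrite -(fineK bfin) -EFinM lee_fin.
    rewrite mulrCA ler_wpM2l ?powR_ge0//.
    by rewrite -ler_pdivrMr// -lee_fin fineK// ratio_le_beta.
  apply: (le_trans (esumZl_le _ _ _ _ _ _ _)) => //.
  rewrite -muleA muleCA; apply: lee_wpmul2l => //.
  exact: esum_comp_le.
apply: gt0_ler_poweR => //; rewrite ?invr_ge0 ?ltW// in_itv/= leey andbT//.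
exact: le_trans S0 le_S.
Qed.

Lemma bounded_comp_ratio_le (K : R) (v : T) :
  (forall f, Lp lambda p f ->
    Lpnorm lambda p (composition_operator phi f) <= K%:E * Lpnorm lambda p f) ->
  (lambda v / lambda (phi v) <= K `^ p)%R.
Proof.
move=> K_bound; pose e u : R[i] := (u \in [set phi v])%:R.
have normE : Lpnorm lambda p e = (lambda (phi v) `^ p^-1)%:E.
  by rewrite Lpnorm_indic esum_set1 ?lee_fin ?ltW.
have := K_bound e; rewrite normE /Lp/= normE ltry => /(_ isT).
have -> : composition_operator phi e =
    (fun u => (u \in phi @^-1` [set phi v])%:R).
  by apply/funext => u; rewrite /composition_operator /= /e.
rewrite Lpnorm_indic => le_K.
have : (lambda v `^ p^-1)%:E <= K%:E * (lambda (phi v) `^ p^-1)%:E.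
  apply: le_trans le_K; rewrite -poweR_EFin.
  (* Of the nonnegative sum over the fibre, only the term at [v] is kept. *)
  have le_v : (lambda v)%:E <= \esum_(u in phi @^-1` [set phi v]) (lambda u)%:E.
    apply: esum_ge; exists [set v]; last by rewrite fsbig_set1.
    by split=> // u ->.
  have v0 : 0 <= (lambda v)%:E by rewrite lee_fin ltW.
  apply: gt0_ler_poweR => //; rewrite ?invr_ge0 ?ltW// in_itv/= leey andbT//.
  exact: le_trans v0 le_v.
rewrite -EFinM lee_fin => le_r.
(* The sign of [K] is not assumed: it is forced, since [K] times a positive number dominates a
   nonnegative one. *)
have K0 : (0 <= K)%R.
  rewrite -(pmulr_lge0 _ (powR_gt0 p^-1 (lambda_gt0 (phi v)))).
  exact: le_trans (powR_ge0 _ _) le_r.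
rewrite ler_pdivrMr//.
(* Raising to the power [p] undoes both roots and turns [K] into its [p]-th power. *)
have := ge0_ler_powR (ltW p_gt0) _ _ le_r.
rewrite !nnegrE powR_ge0 mulr_ge0 ?powR_ge0// => /(_ isT isT).
rewrite powRM ?powR_ge0// -!powRrM mulVf ?gt_eqF//.
by rewrite !powRr1 ?(ltW (lambda_gt0 _)).
Qed.

End Lp_facts.

Theorem theorem3p5 (R : realType) (T : tree) (lambda : T -> R) (p : R)
    (phi : T -> T) (M : R)
    (lambda_gt0 : forall v, (0 < lambda v)%R)
    (p_ge1 : (1 <= p)%R)
    (fibre_le : forall v, range phi v ->
      counting (phi @^-1` [set v]) <= M%:E) :
  (bounded_operator lambda p (composition_operator phi)
     <-> beta lambda phi \is a fin_num) /\
  (bounded_operator lambda p (composition_operator phi) ->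
     operator_norm lambda p (composition_operator phi)
       <= (M%:E * beta lambda phi) `^ p^-1).
Proof.
have p_gt0 : (0 < p)%R by exact: lt_le_trans p_ge1.
(* The image of the root lies in the range, so [M] bounds the cardinality of an actual fibre. *)
have M0 : (0 <= M)%R.
  rewrite -lee_fin.
  apply: le_trans (fibre_le (phi (Defs.root T)) (imageT _ _)).
  by rewrite /counting; case: asboolP => _; rewrite ?leey ?lee_fin.
have b0 : 0 <= beta lambda phi by exact: beta_ge0 (Defs.root T).
have bdd_beta : bounded_operator lambda p (composition_operator phi) ->
    beta lambda phi \is a fin_num.
  move=> [_ _ [K K_bound]]; rewrite ge0_fin_numE//.
  apply: le_lt_trans (ltry (K `^ p)); apply: ge_ereal_sup => _ [v _ <-].
  by rewrite lee_fin; exact: bounded_comp_ratio_le K_bound.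
have norm_le f : beta lambda phi \is a fin_num ->
    Lpnorm lambda p (composition_operator phi f) <=
    (M%:E * beta lambda phi) `^ p^-1 * Lpnorm lambda p f.
  by move=> bfin; exact: (Lpnorm_comp_le _ _ _ _ _ _ _ (Defs.root T)).
split; last first.
  move=> /bdd_beta bfin; apply: ge_ereal_sup => _ [f /= f1 <-].
  apply: le_trans (norm_le f bfin) _.
  by rewrite -[leRHS]mule1 lee_wpmul2l ?poweR_ge0.
split=> // bfin.
have cfin : (M%:E * beta lambda phi) `^ p^-1 \is a fin_num.
  by rewrite fin_num_poweR// fin_numM.
(* Linearity of composition holds by computation, leaving the invariance of [Lp] and the choice of a
   real constant. *)
split=> //.
- move=> f /= fLp; rewrite /Lp/=; apply: le_lt_trans (norm_le f bfin) _.
  rewrite -ge0_fin_numE ?mule_ge0 ?poweR_ge0 ?Lpnorm_ge0//.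
  by rewrite fin_numM// ge0_fin_numE ?Lpnorm_ge0.
- exists (fine ((M%:E * beta lambda phi) `^ p^-1)) => f _.
  by rewrite fineK//; exact: norm_le.
Qed.
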